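(* There exists a binary linear code of length $108$, dimension $29$ and minimum distance $32$. *)

(* Defs.v *)
From mathcomp Require Import all_boot all_order all_algebra.
Set Implicit Arguments. Unset Strict Implicit. Unset Printing Implicit Defensive.
Import GRing.Theory.
Local Open Scope ring_scope.

Definition bin_code (n : nat) := {vspace 'rV['F_2]_n}.

Definition hdist (n : nat) (x y : 'rV['F_2]_n) : nat := #|[set i | x 0 i != y 0 i]|.

Definition is_min_dist (n : nat) (C : bin_code n) (d : nat) : Prop :=
  (exists x y, [/\ x \in C, y \in C, x != y & hdist x y = d]) /\
  (forall x y, x \in C -> y \in C -> x != y -> (d <= hdist x y)%N).

(* Main.v *)
(** The code has length 108 = 3 * 35 + 3. It is quasi-cyclic of index 3 on the first 105 coordinates (coordinate 3t + j is position t of circulant block j), while coordinates 105, 106, 107 are the parity bits of the three blocks and are fixed by the shift t -> t + 1.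

The code is generated by pairwise orthogonal words of weight divisible by 4, so all weights are divisible by 4 and a nonzero word of weight below 32 has weight at most 28. By the cycle lemma some shift of such a word has at most 4k/5 ones among its first 3k coordinates, for every k up to 35. A backtracking search over the pivot bits, pruned by these bounds, visits a few million nodes and finds that only the zero word satisfies them on the first 105 coordinates. *)

From Stdlib Require Import NArith.
Require Import Defs.
From mathcomp Require Import all_boot all_order all_algebra.
From mathcomp Require Import zify.
Set Implicit Arguments. Unset Strict Implicit. Unset Printing Implicit Defensive.
Import GRing.Theory.

(** * Bit words under coordinatewise sum and product *)

Fixpoint xorw (a b : bitseq) : bitseq :=
  if a is x :: a' then if b is y :: b' then (x (+) y) :: xorw a' b' else [::] else [::].

Fixpoint andw (a b : bitseq) : bitseq :=
  if a is x :: a' then if b is y :: b' then (x && y) :: andw a' b' else [::] else [::].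

Lemma size_xorw a b : size (xorw a b) = minn (size a) (size b).
Proof. by elim: a b => [|x a IH] [|y b] //=; rewrite IH minnSS. Qed.

Lemma xorwA a b c : xorw a (xorw b c) = xorw (xorw a b) c.
Proof. by elim: a b c => [|x a IH] [|y b] [|z c] //=; rewrite IH addbA. Qed.

Lemma xorwC a b : xorw a b = xorw b a.
Proof. by elim: a b => [|x a IH] [|y b] //=; rewrite IH addbC. Qed.

Lemma andwC a b : andw a b = andw b a.
Proof. by elim: a b => [|x a IH] [|y b] //=; rewrite IH andbC. Qed.

Lemma xorwK a b : size a = size b -> xorw a (xorw a b) = b.
Proof. by elim: a b => [|x a IH] [|y b] //= [/IH->]; rewrite addKb. Qed.

Lemma take_xorw n a b : take n (xorw a b) = xorw (take n a) (take n b).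
Proof. by elim: n a b => [|n IH] [|x a] [|y b] //=; rewrite IH. Qed.

Lemma drop_xorw n a b : drop n (xorw a b) = xorw (drop n a) (drop n b).
Proof. by elim: n a b => [|n IH] [|x a] [|y b] //=; case: drop. Qed.

Lemma xorw_cat a b c d :
  size a = size b -> xorw (a ++ c) (b ++ d) = xorw a b ++ xorw c d.
Proof. by elim: a b => [|x a IH] [|y b] //= [/IH->]. Qed.

Lemma nth_xorw a b i : size a = size b ->
  nth false (xorw a b) i = nth false a i (+) nth false b i.
Proof. by elim: a b i => [|x a IH] [|y b] [|i] //= [/IH]. Qed.

Lemma count_xorw a b : size a = size b ->
  count id (xorw a b) + (count id (andw a b)).*2 = count id a + count id b.
Proof. by elim: a b => [|[] a IH] [|[] b] //= [/IH]; lia. Qed.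

Lemma odd_andw_xorw a b c : size a = size b ->
  odd (count id (andw (xorw a b) c)) =
  odd (count id (andw a c)) (+) odd (count id (andw b c)).
Proof.
elim: a b c => [|x a IH] [|y b] [|z c] //= [/IH{}IH].
rewrite !oddD IH; case: (odd (count _ _)); case: (odd (count _ _));
  by case: x; case: y; case: z.
Qed.

(** * Row vectors over the field of two elements as bit words *)

Section Words.
Local Open Scope ring_scope.
Variable n : nat.
Implicit Types x y : 'rV['F_2]_n.

Definition vec (w : bitseq) : 'rV['F_2]_n := \row_i (nth false w i)%:R.

Definition bits x : bitseq := [seq x 0 i != 0 | i <- enum 'I_n].

Lemma F2_bool (c : 'F_2) : (c != 0)%:R = c.
Proof. by apply/val_inj; case: c => [[|[|?]]]. Qed.

Lemma natr_addb (b c : bool) : (b (+) c)%:R = b%:R + c%:R :> 'F_2.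
Proof. by apply/val_inj; case: b c => [] []. Qed.

Lemma size_bits x : size (bits x) = n.
Proof. by rewrite size_map size_enum_ord. Qed.

Lemma nth_bits x (i : 'I_n) : nth false (bits x) i = (x 0 i != 0).
Proof. by rewrite (nth_map i) ?size_enum_ord // nth_ord_enum. Qed.

Lemma bitsK x : vec (bits x) = x.
Proof. by apply/rowP => i; rewrite mxE nth_bits F2_bool. Qed.

Lemma vecK w : size w = n -> bits (vec w) = w.
Proof.
move=> sw; apply: (@eq_from_nth _ false) => [|i]; rewrite size_bits // => lt_i.
by rewrite (nth_bits _ (Ordinal lt_i)) mxE /=; case: nth.
Qed.

Lemma vec_xorw a b : size a = size b -> vec (xorw a b) = vec a + vec b.
Proof. by move=> sab; apply/rowP => i; rewrite !mxE nth_xorw // natr_addb. Qed.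

Lemma vec0 k : vec (nseq k false) = 0.
Proof. by apply/rowP => i; rewrite !mxE nth_nseq if_same. Qed.

Lemma bitsD x y : bits (x + y) = xorw (bits x) (bits y).
Proof.
rewrite -{1}(bitsK x) -{1}(bitsK y) -vec_xorw ?size_bits // vecK //.
by rewrite size_xorw !size_bits minnn.
Qed.

Lemma bits0 : bits 0 = nseq n false.
Proof. by rewrite -(vec0 n) vecK ?size_nseq. Qed.

Lemma hdist_bits x y : hdist x y = count id (bits (x - y)).
Proof.
rewrite /hdist count_map -sum1_count -sum1_card big_enum_cond.
by apply: eq_bigl => i /=; rewrite !inE !mxE subr_eq0.
Qed.

(** The only scalars are 0 and 1, so a span consists of the sums of generators. *)
Lemma span_F2_ind (X : seq 'rV['F_2]_n) (P : 'rV['F_2]_n -> Prop) :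
  P 0 -> (forall g x, g \in X -> P x -> P (g + x)) ->
  forall x, x \in <<X>>%VS -> P x.
Proof.
elim: X P => [|g X IH] P P0 PD x; first by rewrite span_nil memv0 => /eqP->.
rewrite span_cons => /memv_addP[_ /vlineP[k ->] [y Xy ->]].
have Py: P y by apply: IH Xy => // h z Xh; apply: PD; rewrite inE Xh orbT.
rewrite -(F2_bool k); case: (k != 0); last by rewrite scale0r add0r.
by rewrite scale1r; apply: PD Py; rewrite inE eqxx.
Qed.

End Words.

(* Cycle lemma: rotating to the block boundary where the prefix weight, corrected by its mean slope [p / q], is largest keeps all prefixes below the mean. *)
Lemma low_rotation b m p q (s : bitseq) : 0 < m -> size s = b * m ->
  q * count id s <= p * m ->
  exists2 i, i < m &
    forall k, k <= m -> q * count id (take (b * k) (rot (b * i) s)) <= p * k.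
Proof.
case: m => // m _ size_s le_s; pose F k := count id (take (b * k) s).
case: (@arg_maxnP _ (ord0 : 'I_m.+1) xpredT (fun i => q * F i + p * (m.+1 - i))) => // i _ max_i.
exists i => // k le_k; have lt_i := ltn_ord i.
have split_s : F i + count id (drop (b * i) s) = count id s.
  by rewrite /F -count_cat cat_take_drop.
have le_bi : b * i <= b * m.+1 by rewrite leq_mul2l ltnW ?orbT.
rewrite /rot take_cat size_drop size_s -mulnBr.
have [lt_k|ge_k] := ltnP (b * k) (b * (m.+1 - i)).
  have lt_ik : i + k < m.+1 by move: lt_k; rewrite ltn_mul2l => /andP[_]; lia.
  have := max_i (Ordinal lt_ik) isT; rewrite /= {1}/F mulnDr takeD count_cat -/(F i).
  rewrite !mulnBr !mulnDr; have := leq_mul2l p k m.+1; have := leq_mul2l p i m.+1.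
  have := leq_mul2l p (i + k) m.+1.
  rewrite mulnDr (ltnW lt_ik) (ltnW lt_i) le_k !orbT; lia.
have [b0|b_gt0] := posnP b.
  by move: size_s; rewrite b0 mul0n => /size0nil->; rewrite /= muln0.
(* Here the rotated prefix wraps around; the bound on the total weight of [s] pays for the full
   turn. *)
have ge_ik : m.+1 - i <= k by rewrite leq_mul2l in ge_k; lia.
have lt_j : i + k - m.+1 < m.+1 by lia.
have := max_i (Ordinal lt_j) isT; rewrite /= {1}/F.
rewrite -mulnBr take_takel ?leq_mul2l ?leq_subLR; last by lia.
rewrite count_cat (_ : k - (m.+1 - i) = i + k - m.+1); last by lia.
move: split_s le_s => <-; rewrite !mulnDr !mulnBr !mulnDr.
have := leq_mul2l p m.+1 (i + k); have := leq_mul2l p i m.+1.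
rewrite mulnDr (ltnW lt_i) !orbT (_ : m.+1 <= i + k); last by lia.
rewrite orbT; lia.
Qed.

(** * Prefix budgets and the pruned search *)

Fixpoint within (cs : bitseq) (r : nat) (w : bitseq) : bool :=
  match cs, w with
  | c :: cs', b :: w' => (b <= r + c) && within cs' (r + c - b) w'
  | _, _ => true
  end.

Lemma within_prefix cs r w :
  (forall j, j <= size cs -> count id (take j w) <= r + count id (take j cs)) ->
  within cs r w.
Proof.
elim: cs r w => [|c cs IH] r [|b w] //= H; rewrite -/(within _ _ _).
have := H 1 isT; rewrite /= !take0 !addn0 => le_b; rewrite le_b /=.
by apply: IH => j le_j; have := H j.+1 le_j; rewrite /=; lia.
Qed.

(* [os] lists, coordinate by coordinate, [Some] of the rest of a row having its pivot there, or [None] at a dependent coordinate; [coset os v w] says that [w] is [v] plus the rows selected by the pivot bits of [w]. *)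
Fixpoint coset (os : seq (option bitseq)) (v w : bitseq) : bool :=
  match os, v, w with
  | Some row :: os', _ :: v', c :: w' =>
      (size row == size v') && coset os' (if c then xorw row v' else v') w'
  | None :: os', b :: v', c :: w' => (b == c) && coset os' v' w'
  | [::], _, _ => true
  | _, _, _ => false
  end.

(** A row selected in both words cancels in the sum, just as its pivot bit does. *)
Lemma coset_xorw os v w v' w' :
  coset os v w -> coset os v' w' -> coset os (xorw v v') (xorw w w').
Proof.
elim: os v w v' w' => [|[row|] os IH] [|b v] [|c w] [|b' v'] [|c' w'] //=.
  case/andP=> /eqP sv Hv /andP[/eqP sv' Hv'].
  rewrite size_xorw -sv -sv' minnn eqxx /=; move: (IH _ _ _ _ Hv Hv').
  case: c c' {Hv Hv'} => [] [] //=; rewrite -?xorwA //.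
    by rewrite (xorwC v) -!xorwA (xorwC v') xorwK // size_xorw -sv -sv' minnn.
  by rewrite xorwA (xorwC v) -xorwA.
by case/andP=> /eqP-> Hv /andP[/eqP-> Hv']; rewrite eqxx (IH _ _ _ _ Hv Hv').
Qed.

(* [nz] records whether a bit 1 has been chosen so far. *)
Fixpoint search (cs : bitseq) (os : seq (option bitseq)) (r : nat) (nz : bool)
    (v : bitseq) : bool :=
  match cs, os, v with
  | c :: cs', o :: os', b :: v' =>
    let r := if c then r.+1 else r in
    match o with
    | None =>
      if b then if r is r'.+1 then search cs' os' r' true v' else true
      else search cs' os' r nz v'
    | Some row =>
      if search cs' os' r nz v' then
        if r is r'.+1 then search cs' os' r' true (xorw row v') else true
      else false
    end
  | _, _, _ => ~~ nz
  end.

(** A branch that needs a 1 when no allowance is left returns [true], because [within] fails there;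
    any other branch ends at [~~ nz]. *)
Lemma searchP cs os r nz v w : size cs = size os -> search cs os r nz v ->
  coset os v w -> within cs r w -> ~~ (nz || has id (take (size os) w)).
Proof.
elim: cs os r nz v w => [|c cs IH] [|o os] r nz [|b v] [|d w] //=;
  rewrite ?orbF //; do ?by case: o.
move=> [size_os]; rewrite addnC.
have -> : (if c then r.+1 else r) = c + r by case: c.
case: o => [row|].
  case: ifP => // S0 S1 /andP[_ Hv]; case: d Hv => Hv; last first.
    by rewrite subn0 => /(IH _ _ _ _ _ size_os S0 Hv).
  case: (c + r) S1 => // r' S1; rewrite subn1.
  by move/(IH _ _ _ _ _ size_os S1 Hv).
move=> S /andP[/eqP<- Hv]; case: b S => S; last first.
  by rewrite subn0 => /(IH _ _ _ _ _ size_os S Hv).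
by case: (c + r) S => // r' S; rewrite subn1 => /(IH _ _ _ _ _ size_os S Hv).
Qed.

(* Bit i of a number is coordinate i. These are the reduced echelon form of the following code, found by computer search. Let beta = z^117, of order 35, in GF(2^12) = F_2[z]/(z^12 + z^6 + z^4 + z + 1), and gamma = z, of order 7, in GF(2^3) = F_2[z]/(z^3 + z + 1). Up to the parity bits, the code is the sum of the binary images of the words with block j given by Tr(x u_j beta^t), Tr(x v_j beta^-t) and Tr(y w_j gamma^-t), where u, v and w have one entry per block and 1 + u_1 v_1 + u_2 v_2 = 0 for self-orthogonality, and of the words constant on each block and equal to 1 on an even number of blocks. Reading the binary digits of an integer as the coefficients of a polynomial in z, u = (1, 1570, 298), v = (1, 2658, 1781) and w = (1, 7, 2). *)
Local Open Scope N_scope.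

Definition row_numbers : seq N := [::
  0xb29057ace88aae5c07400000001;
  0xccfdddb8364e20db4d408200002;
  0xce575a0551c1418806808200004;
  0x7ad5e762159433683c808200008;
  0xb98367d56cb5885d20049200010;
  0xacd75a3e50ce82c77e049200020;
  0x7405bcadcb2efa12afc41000040;
  0xaeb1b916022323ba4be49000080;
  0xd8d75be658b098bcba241200100;
  0x1ceae8c7e03c3f417fe00200200;
  0xcbe042a4cfdd935515240200400;
  0xc410588fa20ba4b69ae09000800;
  0xb76d962e8ee43504b3801001000;
  0x13ffc89e48a2ba73e4609202000;
  0x721293d1f8d78be8d0448004000;
  0xc7abbcddce6a47f19dc00208000;
  0xd1a91ef714d4921725841210000;
  0xbec3c48a977d1ece84a48220000;
  0x6fcdb1429bd891d0e9401040000;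
  0x31fadbdf765d1312aa01280000;
  0x624f44534ed397b69a41100000;
  0x18fd6defbb2e898955009400000;
  0xa3b7f5854fe365874a608800000;
  0x541e8c0befb2d19e3c4a000000;
  0xbdbfac2a7f1b2c3a53044000000;
  0xb89f11a91f53c69319650000000;
  0x1dc7b14277dcaeddd4a20000000;
  0xa6520af59d1155cb80e80000000;
  0xbe075a0231e0b9e1e9900000000].

Local Close Scope N_scope.

(** * The generators and the facts about them checked by computation *)

Definition rows : seq bitseq :=
  [seq mkseq (N.testbit_nat x) 108 | x <- row_numbers].

Definition pivot (r : bitseq) : nat := index true r.

Definition lincomb (bs : bitseq) : bitseq :=
  foldr xorw (nseq 108 false) (mask bs rows).

Definition shift (w : bitseq) : bitseq := rot 3 (take 105 w) ++ drop 105 w.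

Lemma size_rows g : g \in rows -> size g = 108.
Proof. by case/mapP => x _ ->; rewrite size_mkseq. Qed.

(** In a reduced echelon form the pivot bits of a codeword are its coefficients; this supplies the
    combination to compare with. *)
Lemma shift_rows :
  all (fun g => shift g == lincomb [seq nth false (shift g) (pivot r) | r <- rows]) rows.
Proof. by vm_compute. Qed.

Lemma rows_reduced :
  all (fun i => all (fun j =>
    nth false (nth [::] rows i) (pivot (nth [::] rows j)) == (i == j))
    (iota 0 29)) (iota 0 29).
Proof. by vm_compute. Qed.

Lemma pivots_lt : all (fun r => pivot r < 108) rows.
Proof. by vm_compute. Qed.

Lemma rows_doubly_even : all (fun g => 4 %| count id g) rows.
Proof. by vm_compute. Qed.

Lemma rows_orthogonal :
  all (fun g => all (fun h => ~~ odd (count id (andw g h))) rows) rows.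
Proof. by vm_compute. Qed.

Definition options : seq (option bitseq) :=
  [seq omap (drop j.+1) (ohead [seq r <- rows | pivot r == j]) | j <- iota 0 105].

(* The slope 4 / 5 is 28 / 35: the largest weight to exclude over the number of shifts. *)
Definition credits : bitseq := [seq (3 %| j) && ~~ (15 %| j) | j <- iota 0 105].

Lemma rows_coset : all (coset options (nseq 108 false)) rows.
Proof. by vm_compute. Qed.

Lemma zero_coset : coset options (nseq 108 false) (nseq 108 false).
Proof. by vm_compute. Qed.

Lemma search_rows : search credits options 0 false (nseq 108 false).
Proof. by vm_compute. Qed.

(** A prefix of length [j] meets [(j + 2) %/ 3] triples of coordinates, and the bound for all of
    these triples is granted as soon as the last one begins. *)
Lemma count_credits : all (fun j =>
  (4 * ((j + 2) %/ 3)) %/ 5 <= count id (take j credits)) (iota 0 106).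
Proof. by vm_compute. Qed.

(** * The code: shift invariance, weights and dimension *)

Definition code : bin_code 108 := <<[seq vec 108 r | r <- rows]>>%VS.

Lemma code_ind (P : bitseq -> Prop) : P (nseq 108 false) ->
  (forall g w, g \in rows -> size w = 108 -> P w -> P (xorw g w)) ->
  forall x, x \in code -> P (bits x).
Proof.
move=> P0 PD; apply: (@span_F2_ind 108 _ (fun x => P (bits x))).
  by rewrite bits0.
move=> _ x /mapP[g rows_g ->] Px; rewrite bitsD vecK ?size_rows //.
by apply: PD; rewrite ?size_bits.
Qed.

Lemma vec_lincomb bs : vec 108 (lincomb bs) \in code.
Proof.
rewrite /lincomb; set z := nseq 108 false.
have : {subset mask bs rows <= rows} by move=> g; apply: mem_mask.
suff {bs} H s : {subset s <= rows} ->
    size (foldr xorw z s) = 108 /\ vec 108 (foldr xorw z s) \in code.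
  by case/H.
elim: s => [|g s IH] sub_s /=; first by rewrite /z vec0 mem0v.
have rows_g : g \in rows by apply: sub_s; rewrite inE eqxx.
have [|sz code_s] := IH; first by move=> h s_h; apply: sub_s; rewrite inE s_h orbT.
rewrite size_xorw sz size_rows // vec_xorw ?sz ?size_rows //; split=> //.
by rewrite memvD // memv_span // map_f.
Qed.

Lemma shift_xorw a b : size a = 108 -> size b = 108 ->
  shift (xorw a b) = xorw (shift a) (shift b).
Proof.
move=> sa sb; rewrite /shift /rot take_xorw !drop_xorw !take_xorw.
by rewrite !xorw_cat // ?size_cat ?size_drop ?size_takel ?sa ?sb.
Qed.

Lemma size_shift w : size (shift w) = size w.
Proof. by rewrite size_cat size_rot -size_cat cat_take_drop. Qed.

Lemma code_shift x : x \in code -> vec 108 (shift (bits x)) \in code.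
Proof.
move: x; apply: (@code_ind (fun w => vec 108 (shift w) \in code)) =>
  [|g w rows_g sw code_w].
  by rewrite (_ : shift _ = nseq 108 false) // vec0 mem0v.
have sg := size_rows rows_g.
rewrite shift_xorw // vec_xorw ?size_shift ?sg ?sw // memvD //.
by rewrite (eqP (allP shift_rows g rows_g)) vec_lincomb.
Qed.

Lemma code_rot x i : i <= 35 -> x \in code ->
  exists2 y, y \in code &
    bits y = rot (3 * i) (take 105 (bits x)) ++ drop 105 (bits x).
Proof.
move=> le_i code_x; elim: i le_i => [|i IH] le_i.
  by exists x; rewrite // muln0 rot0 cat_take_drop.
have s105 : size (take 105 (bits x)) = 105 by rewrite size_takel // size_bits.
have [y code_y bits_y] := IH (ltnW le_i).
exists (vec 108 (shift (bits y))); first exact: code_shift.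
rewrite vecK ?size_shift ?size_bits // bits_y /shift.
rewrite take_size_cat ?drop_size_cat ?size_rot ?s105 // mulnS rotD //.
by rewrite s105; lia.
Qed.

Lemma code_doubly_even x : x \in code -> 4 %| count id (bits x).
Proof.
move=> code_x.
(* Orthogonality to the rows is carried along: by [count_xorw] a sum loses twice the overlap, which
   is a multiple of 4 when the overlap is even. *)
pose P w := (4 %| count id w) && all (fun h => ~~ odd (count id (andw w h))) rows.
suff /andP[] : P (bits x) by [].
move: x code_x; apply: (@code_ind P) => [|g w rows_g sw /andP[dvd_w /allP even_w]].
  by vm_compute.
have sg := size_rows rows_g; rewrite -sw in sg.
have dvd_g := allP rows_doubly_even g rows_g.
have even_g := allP (allP rows_orthogonal g rows_g).
apply/andP; split; last first.
  apply/allP => h rows_h; rewrite odd_andw_xorw // negb_add.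
  by rewrite (negbTE (even_g h rows_h)) (negbTE (even_w h rows_h)).
have even_gw : ~~ odd (count id (andw g w)).
  by rewrite andwC even_w.
have := count_xorw sg; lia.
Qed.

Lemma code_coset x : x \in code -> coset options (nseq 108 false) (bits x).
Proof.
move: x; apply: (@code_ind (fun w => coset options (nseq 108 false) w)) =>
  [|g w rows_g _ coset_w]; first exact: zero_coset.
exact: (coset_xorw (allP rows_coset g rows_g) coset_w).
Qed.

Lemma code_weight x : x \in code -> x != 0%R -> 32 <= count id (bits x).
Proof.
move=> code_x; apply: contraR; rewrite -ltnNge => lt_x.
have dvd_x := code_doubly_even code_x.
have le_x : count id (bits x) <= 28 by lia.
set s := take 105 (bits x).
have size_s : size s = 3 * 35 by rewrite size_takel ?size_bits.
have split_x : count id s + count id (drop 105 (bits x)) = count id (bits x).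
  by rewrite -count_cat cat_take_drop.
have [|i lt_i low_i] := @low_rotation 3 35 4 5 s isT size_s; first lia.
have [y code_y bits_y] := code_rot (ltnW lt_i) code_x.
have within_y : within credits 0 (bits y).
  apply: within_prefix => j; rewrite size_map size_iota => le_j.
  have le_k : (j + 2) %/ 3 <= 35 by lia.
  have := allP count_credits j; rewrite mem_iota /= => /(_ le_j).
  apply: leq_trans; rewrite bits_y takel_cat ?size_rot ?size_s //.
  rewrite leq_divRL //; have := low_i _ le_k.
  have le_jk : j <= 3 * ((j + 2) %/ 3) by lia.
  rewrite -[X in count id (take X _)](subnKC le_jk) takeD count_cat -/s; lia.
have := searchP _ search_rows (code_coset code_y) within_y.
rewrite !size_map size_iota => /(_ erefl); rewrite /= has_count -leqNgt leqn0.
rewrite bits_y take_size_cat ?size_rot // => /eqP count0.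
have count_s : count id s = 0 by rewrite -count0; apply/permP; rewrite perm_sym perm_rot.
(* Only the three parity bits can still be 1, and a weight of at most 3 that is divisible by 4 is
   0. *)
have le3 : count id (drop 105 (bits x)) <= 3.
  by rewrite (leq_trans (count_size _ _)) // size_drop size_bits.
have : ~~ has id (bits x) by rewrite has_count; lia.
move/hasPn => no_bit; apply/eqP/rowP => j; rewrite mxE; apply/eqP.
by rewrite -[_ == _]negbK -nth_bits no_bit // mem_nth // size_bits.
Qed.

Lemma dim_code : \dim code = 29.
Proof.
pose basis := [seq vec 108 r | r <- rows].
suff /eqP : free (in_tuple basis) by [].
apply/freeP => k sum0 j.
have lt_p : pivot (nth [::] rows j) < 108.
  by apply: (allP pivots_lt); rewrite mem_nth.
have mem29 (i : 'I_(size basis)) : nat_of_ord i \in iota 0 29.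
  by rewrite mem_iota; apply: ltn_ord.
(* In the pivot column of row [j] only row [j] has a 1, so this column isolates the coefficient
   [k j]. *)
have entry (i : 'I_(size basis)) : (nth 0%R basis i) 0%R (Ordinal lt_p) = (i == j)%:R%R.
  rewrite (nth_map [::]) // mxE.
  by rewrite (eqP (allP (allP rows_reduced i (mem29 i)) j (mem29 j))).
have := congr1 (fun v : 'rV_108 => v 0%R (Ordinal lt_p)) sum0.
rewrite mxE summxE (bigD1 j) //= big1 => [|i /negbTE ne_ij].
  by rewrite mxE entry eqxx mulr1 addr0.
by rewrite mxE entry ne_ij mulr0.
Qed.

Theorem theorem5p3 :
  exists C : bin_code 108, \dim C = 29%N /\ is_min_dist C 32.
Proof.
exists code; split; first exact: dim_code.
split=> [|x y code_x code_y ne_xy]; last first.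
  by rewrite hdist_bits code_weight ?memvB // subr_eq0.
(* This generator has weight exactly 32. *)
have rows_r : nth [::] rows 2 \in rows by apply: mem_nth.
have w_r : hdist (vec 108 (nth [::] rows 2)) 0 = 32.
  by rewrite hdist_bits subr0 vecK ?size_rows //; vm_compute.
exists (vec 108 (nth [::] rows 2)), 0%R; split; rewrite ?mem0v //.
  by rewrite memv_span // map_f.
apply: contra_eq_neq w_r => ->.
by rewrite hdist_bits subr0 bits0.
Qed.
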